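(* There exists an absolute constant $c>0$ such that for every $n\in\mathbb{N}$ (with $n \geq 1$) and for every convex polytope $P\subset\mathbb{R}^n$ with nonempty interior which is symmetric about the origin (that is, $P=-P$), $$\log|V|\cdot\log|\mathcal{F}|\ \geq\ c\,n,$$ where $V$ and $\mathcal{F}$ are the sets of vertices and of facets of $P$, respectively. Moreover, the same estimate holds for every (not necessarily origin-symmetric) convex polytope $P\subset\mathbb{R}^n$ satisfying $B_n\subset P\subset\sqrt{n}\,B_n$. Furthermore, one can take $c=c_n=\frac19+o(1)$ as $n\to\infty$; that is, there is a sequence of real numbers $(c_n)_{n\ge 1}$ depending only on $n$, with $c_n\to\frac19$ as $n\to\infty$, such that $\log|V|\cdot\log|\mathcal{F}|\geq c_n n$ for every $n$ and every polytope $P\subset\mathbb{R}^n$ in either of the two classes above.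
   Context: $B_n$ denotes the closed Euclidean unit ball in $\mathbb{R}^n$ centered at the origin. A convex polytope is the convex hull of a finite nonempty set of points. The vertices of $P\subset\mathbb{R}^n$ are its $0$-dimensional faces, and the facets of $P$ are its $(n-1)$-dimensional faces. $|\cdot|$ denotes the cardinality of a finite set, and $\log$ is the natural logarithm (base $e$). *)

(* Defs.v *)
From HB Require Import structures.
From mathcomp Require Import all_boot all_order all_algebra finmap.
From mathcomp Require Import all_classical all_reals all_analysis.

Set Implicit Arguments.
Unset Strict Implicit.
Unset Printing Implicit Defensive.

Import Order.TTheory GRing.Theory Num.Theory.
Import numFieldNormedType.Exports.

Local Open Scope classical_set_scope.
Local Open Scope ring_scope.

(* R^n is 'rV[R]_n. The library's norm on row vectors is the sup norm, hence
   the separate Euclidean norm below; the topologies agree. *)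

Definition dotp (R : realType) (n : nat) (u v : 'rV[R]_n) : R :=
  \sum_(i < n) u 0 i * v 0 i.

Definition enorm (R : realType) (n : nat) (x : 'rV[R]_n) : R :=
  Num.sqrt (dotp x x).

Definition eball (R : realType) (n : nat) (r : R) : set 'rV[R]_n :=
  [set x | enorm x <= r].

Definition convex_hull (R : realType) (n : nat) (A : set 'rV[R]_n) :
    set 'rV[R]_n :=
  smallest (@convex_set R 'rV[R]_n) A.

Definition polytope (R : realType) (n : nat) (P : set 'rV[R]_n) : Prop :=
  exists A : set 'rV[R]_n, [/\ finite_set A, A !=set0 & P = convex_hull A].

Definition affine_set (R : realType) (n : nat) (A : set 'rV[R]_n) : Prop :=
  forall (x y : 'rV[R]_n) (t : R), A x -> A y -> A (t *: x + (1 - t) *: y).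

Definition affine_hull (R : realType) (n : nat) (A : set 'rV[R]_n) :
    set 'rV[R]_n :=
  smallest (@affine_set R n) A.

(* The empty set has no dimension in this sense (its affine hull is empty). *)
Definition has_dim (R : realType) (n : nat) (A : set 'rV[R]_n) (k : nat) :
    Prop :=
  exists (p : 'rV[R]_n) (W : {vspace 'rV[R]_n}),
    affine_hull A = [set p + w | w in [set` W]] /\ \dim W = k.

(* u = 0 is allowed, so that P itself and the empty set are faces of P. *)
Definition face (R : realType) (n : nat) (P F : set 'rV[R]_n) : Prop :=
  exists (u : 'rV[R]_n) (b : R),
    (forall x, P x -> dotp u x <= b) /\ F = P `&` [set x | dotp u x = b].

Definition faces_of_dim (R : realType) (n : nat) (P : set 'rV[R]_n)
    (k : nat) : set (set 'rV[R]_n) :=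
  [set F | face P F /\ has_dim F k].

(* A vertex v is represented by the face [set v]. *)
Definition vertices (R : realType) (n : nat) (P : set 'rV[R]_n) :
    set (set 'rV[R]_n) :=
  faces_of_dim P 0.

Definition facets (R : realType) (n : nat) (P : set 'rV[R]_n) :
    set (set 'rV[R]_n) :=
  faces_of_dim P n.-1.

(* A polytope has finitely many faces. The junk value for an infinite set S is
   #|` fset_set S| = 0, for which ln 0 = 0, so a positive lower bound on this
   product also asserts that both sets are finite. *)
Definition log_vertices_facets (R : realType) (n : nat) (P : set 'rV[R]_n) :
    R :=
  ln (#|` fset_set (vertices P)|%:R : R) * ln (#|` fset_set (facets P)|%:R : R).

Definition symmetric_body (R : realType) (n : nat) (P : set 'rV[R]_n) : Prop :=
  interior P !=set0 /\ P = -%R @` P.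

Definition between_balls (R : realType) (n : nat) (P : set 'rV[R]_n) : Prop :=
  eball 1 `<=` P /\ P `<=` eball (Num.sqrt (n%:R : R)).

(* Main.v *)
Require Import Defs.
From HB Require Import structures.
From mathcomp Require Import all_boot all_order all_algebra finmap.
From mathcomp Require Import all_classical all_reals all_analysis.
From mathcomp Require Import ring lra.

Set Implicit Arguments.
Unset Strict Implicit.
Unset Printing Implicit Defensive.

Import Order.TTheory GRing.Theory Num.Theory.
Import numFieldNormedType.Exports.

Local Open Scope classical_set_scope.
Local Open Scope ring_scope.

(** Let P be the convex hull of a finite set A, with the origin in its
    interior.  Write v for the vertices of P and u for the normals of its
    facets, scaled so that a facet is the part of P on which u is 1.

    Duality between P and its polar body gives, for all vectors x and y,
<<
        <x, y> <= max_v <v, x> * max_u <u, y>.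
>>
    Suppose first that every v has norm at most 1 and every u norm at most
    sqrt n (this is P between two concentric balls of ratio sqrt n), and take
    x = y = e, a vector of signs.  The left-hand side is n.  For a uniformly
    random e, the inner product with a fixed vector of norm at most 1 is
    subgaussian, because cosh t <= exp (t^2 / 2); a union bound therefore
    yields one e for which the two maxima are at most sqrt (2 ln (2 |V|)) and
    sqrt n * sqrt (2 ln (2 |F|)).  Hence n <= 4 ln (2 |V|) ln (2 |F|)
    ([dimension_le_ln_mul_ln]).  Since |V| and |F| exceed n, each ln (2 k) is
    at most 3/2 ln k as soon as n >= 3, and 4 * (3/2)^2 = 9.  The two remaining
    dimensions are checked by hand ([le_ln_mul_ln]), so that the constant 1/9
    works in every dimension.

    An origin-symmetric P need not lie between two such balls, but some linear
    image of it does.  Instead of moving P, the argument takes x = e S^T and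
    y = e T^T with S^T T = 1, which only asks the vectors v S to have norm at
    most 1 and the vectors u T norm at most sqrt n.  The matrix S maximises the
    determinant subject to the first condition; if the second one failed at
    some point of the polar body, stretching S in that direction would increase
    the determinant ([exists_minimal_ellipsoid]).

    The duality inequality has to be expressed with the actual vertices and
    facets.  A linear functional attains its maximum over A at a vertex
    ([exists_vertex]), and its maximum over the polar body at the normal of a
    facet ([exists_facet_normal]).  Both are found by the same device: among
    the maximisers, one of largest Euclidean norm is extreme. *)

(** * The hyperbolic cosine *)

Lemma derive_le0_le_at0 (R : realType) (f df : R -> R) (x : R) :
  (forall t : R, is_derive t (1 : R) f (df t)) ->
  (forall t : R, 0 <= t -> df t <= 0) ->
  0 <= x -> f x <= f 0.
Proof.
move=> fdf df_le0 x_ge0.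
have d1f t : derive1 f t = df t by rewrite derive1E; apply: derive_val.
apply: (@ler0_derive1_le_cc R f 0 x) => //; rewrite ?in_itv/= ?lexx ?x_ge0//.
- by move=> t /itvP t0x; rewrite d1f df_le0// t0x.
- apply: continuous_subspaceT => t.
  by apply: differentiable_continuous; apply/derivable1_diffP.
Qed.

Lemma sinh_le_mul_cosh (R : realType) (x : R) : 0 <= x ->
  expR x - expR (- x) <= x * (expR x + expR (- x)).
Proof.
move=> x_ge0; rewrite -subr_le0.
pose f (t : R) := expR t - expR (- t) - t * (expR t + expR (- t)).
pose df (t : R) := - (t * (expR t - expR (- t))).
have fdf (t : R) : is_derive t (1 : R) f (df t).
  have dexpN : is_derive t (1 : R) (fun s : R => expR (- s)) (- expR (- t)).
    by rewrite -mulrN1; exact: (@is_derive1_comp R expR -%R).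
  by rewrite /f; apply: is_derive_eq; rewrite /df /GRing.scale/=; ring.
have -> : expR x - expR (- x) - x * (expR x + expR (- x)) = f x by [].
apply: le_trans (@derive_le0_le_at0 R f df x fdf _ x_ge0) _.
  move=> t t_ge0; rewrite /df oppr_le0 mulr_ge0// subr_ge0 ler_expR.
  by rewrite (le_trans _ t_ge0)// oppr_le0.
by rewrite /f oppr0 subrr mul0r subrr.
Qed.

(** The quotient of the two sides is a decreasing function of x >= 0: the sign
    of its derivative is that of sinh x - x cosh x. *)
Lemma cosh_le_expR_sqr (R : realType) (x : R) :
  expR x + expR (- x) <= 2 * expR (x ^+ 2 / 2).
Proof.
wlog x_ge0 : x / 0 <= x.
  move=> H; have [/H//|/ltW x_le0] := leP 0 x.
  by have := H (- x); rewrite opprK sqrrN addrC oppr_ge0; apply.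
pose f (t : R) := (expR t + expR (- t)) * expR (- (t ^+ 2 / 2)).
pose df (t : R) := (expR t - expR (- t) - t * (expR t + expR (- t)))
  * expR (- (t ^+ 2 / 2)).
have fdf (t : R) : is_derive t (1 : R) f (df t).
  have dsqr : is_derive t (1 : R) (fun s : R => - (s ^+ 2 / 2)) (- t).
    by apply: is_derive_eq; rewrite /GRing.scale/=; field.
  have dgauss : is_derive t (1 : R) (fun s : R => expR (- (s ^+ 2 / 2)))
      (expR (- (t ^+ 2 / 2)) * - t).
    exact: (@is_derive1_comp R expR (fun s => - (s ^+ 2 / 2))).
  have dexpN : is_derive t (1 : R) (fun s : R => expR (- s)) (- expR (- t)).
    by rewrite -mulrN1; exact: (@is_derive1_comp R expR -%R).
  by rewrite /f; apply: is_derive_eq; rewrite /df /GRing.scale/=; ring.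
have := @derive_le0_le_at0 R f df x fdf _ x_ge0.
rewrite {2}/f oppr0 expr0n/= mul0r oppr0 expR0 mulr1 /f.
rewrite [expR (- (x ^+ 2 / 2))]expRN ler_pdivrMr ?expR_gt0//; apply => t t_ge0.
by rewrite /df pmulr_lle0 ?expR_gt0// subr_le0 sinh_le_mul_cosh.
Qed.

(** * The Euclidean inner product *)

Section DotProduct.
Context {R : realType} {n : nat}.
Implicit Types (u v w x y : 'rV[R]_n) (t : R).

Lemma dotpE u v : dotp u v = (u *m v^T) 0 0.
Proof. by rewrite mxE; apply: eq_bigr => i _; rewrite mxE. Qed.

Lemma dotpC u v : dotp u v = dotp v u.
Proof. by apply: eq_bigr => i _; rewrite mulrC. Qed.

Lemma dotpDr u v w : dotp u (v + w) = dotp u v + dotp u w.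
Proof. by rewrite !dotpE linearD mulmxDr mxE. Qed.

Lemma dotpZr t u v : dotp u (t *: v) = t * dotp u v.
Proof. by rewrite !dotpE linearZ/= -scalemxAr mxE. Qed.

Lemma dotpDl u v w : dotp (u + v) w = dotp u w + dotp v w.
Proof. by rewrite dotpC dotpDr !(dotpC w). Qed.

Lemma dotpZl t u v : dotp (t *: u) v = t * dotp u v.
Proof. by rewrite dotpC dotpZr dotpC. Qed.

Lemma dotpNr u v : dotp u (- v) = - dotp u v.
Proof. by rewrite -scaleN1r dotpZr mulN1r. Qed.

Lemma dotpNl u v : dotp (- u) v = - dotp u v.
Proof. by rewrite dotpC dotpNr dotpC. Qed.

Lemma dotp0r u : dotp u 0 = 0.
Proof. by rewrite dotpE trmx0 mulmx0 mxE. Qed.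

Lemma dotp0l u : dotp 0 u = 0.
Proof. by rewrite dotpC dotp0r. Qed.

Lemma dotp_mulmx (M : 'M[R]_n) u v : dotp (u *m M) v = dotp u (v *m M^T).
Proof. by rewrite !dotpE trmx_mul trmxK mulmxA. Qed.

Lemma dotp_ge0 u : 0 <= dotp u u.
Proof. by apply: sumr_ge0 => i _; rewrite -expr2 sqr_ge0. Qed.

Lemma sqr_coord_le_dotp u (i : 'I_n) : u 0 i ^+ 2 <= dotp u u.
Proof.
rewrite /dotp (bigD1 i)//= expr2 lerDl.
by apply: sumr_ge0 => j _; rewrite -expr2 sqr_ge0.
Qed.

Lemma dotp_eq0 u : (dotp u u == 0) = (u == 0).
Proof.
apply/eqP/eqP => [u0|->]; last exact: dotp0r.
apply/rowP => i; rewrite mxE; apply/eqP.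
by rewrite -sqrf_eq0 eq_le sqr_ge0 andbT -u0 sqr_coord_le_dotp.
Qed.

Lemma dotp_gt0 u : (0 < dotp u u) = (u != 0).
Proof. by rewrite lt0r dotp_eq0 dotp_ge0 andbT. Qed.

Lemma sqr_enorm u : enorm u ^+ 2 = dotp u u.
Proof. by rewrite sqr_sqrtr// dotp_ge0. Qed.

Lemma enorm_ge0 u : 0 <= enorm u.
Proof. exact: sqrtr_ge0. Qed.

Lemma enorm_gt0 u : (0 < enorm u) = (u != 0).
Proof. by rewrite sqrtr_gt0 dotp_gt0. Qed.

End DotProduct.

(** * Random signs *)

Section Signs.
Context {R : realType} {n : nat}.

Definition sign_row (e : {ffun 'I_n -> bool}) : 'rV[R]_n :=
  \row_i (-1) ^+ e i.

Lemma dotp_sign_row e : dotp (sign_row e) (sign_row e) = n%:R.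
Proof.
rewrite /dotp (eq_bigr (fun=> 1)) => [|i _].
  by rewrite sumr_const card_ord.
by rewrite !mxE -signr_addb addbb.
Qed.

(** The exponential moment factors over the independent signs, and each factor
    is a hyperbolic cosine. *)
Lemma sum_expR_sign (p : 'rV[R]_n) :
  \sum_e expR (dotp p (sign_row e)) <= 2 ^+ n * expR (dotp p p / 2).
Proof.
pose F (i : 'I_n) (b : bool) := expR (p 0 i * (-1) ^+ b).
rewrite (eq_bigr (fun e : {ffun 'I_n -> bool} => \prod_i F i (e i))).
  rewrite -bigA_distr_bigA mulr_suml expR_sum.
  rewrite -[in 2 ^+ n](card_ord n) -prodr_const.
  rewrite -big_split/=; apply: ler_prod => i _; rewrite !big_bool /F/=.
  rewrite addr_ge0 ?expR_ge0//= mulrN1 mulr1 addrC -expr2.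
  exact: cosh_le_expR_sqr.
move=> e _; rewrite -expR_sum; congr expR.
by apply: eq_bigr => i _; rewrite mxE.
Qed.

(** Chernoff and union bounds at once, with a threshold for each vector: the
    hypothesis on the sum bounds the expected value of a sum of exponentials,
    each of which exceeds 1 when its threshold is passed. *)
Lemma exists_sign_le (K : finType) (p : K -> 'rV[R]_n) (s : K -> R) :
  (forall k, 0 < s k) -> (forall k, dotp (p k) (p k) <= 1) ->
  \sum_k expR (- (s k ^+ 2 / 2)) <= 1 ->
  exists e, forall k, dotp (p k) (sign_row e) <= s k.
Proof.
move=> s_gt0 p_le1 sum_le1.
pose G (e : {ffun 'I_n -> bool}) k :=
  expR (dotp (s k *: p k) (sign_row e) - s k ^+ 2).
have sumG : \sum_e \sum_k G e k <= \sum_(e : {ffun 'I_n -> bool}) 1.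
  rewrite exchange_big/= sumr_const card_ffun card_bool card_ord.
  apply: (@le_trans _ _ (2 ^+ n * \sum_k expR (- (s k ^+ 2 / 2)))); last first.
    by rewrite natrX ler_piMr// exprn_ge0.
  rewrite mulr_sumr; apply: ler_sum => k _.
  rewrite -(eq_bigr _ (fun e _ => esym (expRD _ _))) -mulr_suml.
  apply: (@le_trans _ _ (2 ^+ n * expR (s k ^+ 2 / 2) * expR (- s k ^+ 2))).
    rewrite ler_pM2r ?expR_gt0//; apply: le_trans (sum_expR_sign _) _.
    rewrite ler_pM2l ?exprn_gt0// ler_expR ler_pM2r ?invr_gt0//.
    by rewrite dotpZl dotpZr mulrA -expr2 ler_piMr// sqr_ge0.
  by rewrite -mulrA -expRD ler_pM2l ?exprn_gt0// ler_expR; lra.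
have [e Ge] : exists e, \sum_k G e k <= 1.
  apply/not_existsP => Hn; move: sumG; apply/negP; rewrite -ltNge.
  apply: ltr_sum => [|e _].
    by apply/hasP; exists [ffun=> true]; rewrite ?mem_index_enum.
  by rewrite ltNge; apply/negP/Hn.
exists e => k.
have : G e k <= 1.
  apply: le_trans Ge; rewrite (bigD1 k)//= lerDl.
  by apply: sumr_ge0 => j _; exact: expR_ge0.
by rewrite expR_le1 subr_le0 dotpZl expr2 ler_pM2l.
Qed.

End Signs.

(** The sign vector e is tested against u S and v T simultaneously, the latter
    after division by sqrt n.  Each family contributes exactly 1/2 to the union
    bound, which is why 2 |I| and 2 |J| appear. *)
Lemma dimension_le_ln_mul_ln (R : realType) (n : nat) (I J : finType)
    (u : I -> 'rV[R]_n) (v : J -> 'rV[R]_n) (S T : 'M[R]_n) :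
  (0 < #|I|)%N -> (0 < #|J|)%N -> (0 < n)%N -> S^T *m T = 1%:M ->
  (forall i, dotp (u i *m S) (u i *m S) <= 1) ->
  (forall j, dotp (v j *m T) (v j *m T) <= n%:R) ->
  (forall x y, exists i j, [/\ 0 <= dotp (u i) x, 0 <= dotp (v j) y &
    dotp x y <= dotp (u i) x * dotp (v j) y]) ->
  n%:R <= 4 * (ln (2 * #|I|%:R) * ln (2 * #|J|%:R)) :> R.
Proof.
move=> I_gt0 J_gt0 n_gt0 ST1 u_le1 v_len dual.
have n0 : 0 < n%:R :> R by rewrite ltr0n.
have ln_gt0 m : (0 < m)%N -> 0 < ln (2 * m%:R) :> R.
  move=> m0; rewrite ln_gt0// -natrM ltr1n.
  by case: m m0 => // m _; rewrite mulnS.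
have sum_half (K : finType) : (0 < #|K|)%N ->
    \sum_(k : K) expR (- (Num.sqrt (2 * ln (2 * #|K|%:R)) ^+ 2 / 2))
      = 2^-1 :> R.
  move=> K0; rewrite sqr_sqrtr ?mulr_ge0// ?(ltW (ln_gt0 _ _))//.
  rewrite mulrC mulKf// expRN lnK; last by rewrite posrE mulr_gt0// ltr0n.
  rewrite sumr_const -(mulr_natr _ #|_|) invfM -mulrA mulVf ?mulr1//.
  by rewrite pnatr_eq0 -lt0n.
pose a : R := Num.sqrt (2 * ln (2 * #|I|%:R)).
pose b : R := Num.sqrt (2 * ln (2 * #|J|%:R)).
have a0 : 0 < a by rewrite sqrtr_gt0 mulr_gt0// ln_gt0.
have b0 : 0 < b by rewrite sqrtr_gt0 mulr_gt0// ln_gt0.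
pose p (k : I + J) := match k with
  | inl i => u i *m S | inr j => (Num.sqrt n%:R)^-1 *: (v j *m T) end.
pose s (k : I + J) := match k with inl _ => a | inr _ => b end.
have [| | |e He] := @exists_sign_le R n _ p s.
- by case.
- case=> [i|j]; rewrite /p//= dotpZl dotpZr mulrA -invfM -expr2 sqr_sqrtr//.
  by rewrite ler_pdivrMl// mulr1.
- by rewrite big_sumType/= !sum_half//; lra.
have [i [j [i0 j0 le_ij]]] := dual (sign_row e *m S^T) (sign_row e *m T^T).
move: le_ij i0 j0; have := He (inl i); have := He (inr j).
rewrite /= dotpZl ler_pdivrMl ?sqrtr_gt0// -!dotp_mulmx => vb ua.
rewrite -mulmxA ST1 mulmx1 dotp_sign_row => le_n i0 j0.
have : n%:R <= a * (Num.sqrt n%:R * b).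
  by apply: le_trans le_n _; apply: ler_pM.
rewrite -[X in X <= _]sqr_sqrtr// mulrCA ler_pM2l ?sqrtr_gt0// => H.
rewrite -[X in X <= _]sqr_sqrtr//.
have : Num.sqrt n%:R * Num.sqrt n%:R <= a * b * (a * b).
  by apply: ler_pM; rewrite ?sqrtr_ge0.
rewrite -expr2 mulrACA -!expr2 /a /b.
rewrite !sqr_sqrtr ?mulr_ge0// ?(ltW (ln_gt0 _ _))//.
by move=> h; lra.
Qed.

(** For n >= 3 both k and l are at least 4 = 2^2, so the factor 2 inside a
    logarithm costs at most a factor 3/2.  For n <= 2 the product of the
    logarithms is at least (ln 2)^2 >= 1/4 > 2/9. *)
Lemma le_ln_mul_ln (R : realType) (n k l : nat) : (0 < n)%N ->
  (n < k)%N -> (n < l)%N ->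
  n%:R <= 4 * (ln (2 * k%:R) * ln (2 * l%:R)) :> R ->
  9^-1 * n%:R <= ln k%:R * ln l%:R :> R.
Proof.
move=> n0 nk nl H.
have k0 : (0 < k)%N by exact: leq_ltn_trans nk.
have l0 : (0 < l)%N by exact: leq_ltn_trans nl.
have ln_le (m m' : nat) : (0 < m)%N -> (m <= m')%N -> ln m%:R <= ln m'%:R :> R.
  by move=> m0 mm; rewrite ler_ln ?posrE ?ltr0n ?ler_nat// (leq_trans m0).
have ln2 : 2^-1 <= ln 2 :> R.
  rewrite -ler_expR lnK ?posrE//.
  have := expR_ge1Dx (- 2^-1 : R); rewrite expRN => h.
  rewrite -[leLHS]invrK invf_ple ?posrE ?invr_gt0 ?expR_gt0//.
  by apply: le_trans h; lra.
have [n3|n3] := leqP 3 n.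
  have ln_mul2 (m : nat) : (3 < m)%N -> ln (2 * m%:R) <= 3 / 2 * ln m%:R :> R.
    move=> m3; rewrite lnM ?posrE ?ltr0n ?(leq_trans _ m3)//.
    have : ln (2 * 2) <= ln m%:R :> R by rewrite -natrM ln_le.
    by rewrite lnM ?posrE//; lra.
  have hk := ln_mul2 k (leq_ltn_trans n3 nk).
  have hl := ln_mul2 l (leq_ltn_trans n3 nl).
  have pos m : (0 < m)%N -> 0 <= ln (2 * m%:R) :> R.
    by move=> m0; rewrite ln_ge0// -natrM ler1n muln_gt0.
  have : ln (2 * k%:R) * ln (2 * l%:R)
      <= 3 / 2 * ln k%:R * (3 / 2 * ln l%:R) :> R.
    by apply: ler_pM; rewrite ?pos.
  lra.
have lk : ln 2 <= ln k%:R :> R by rewrite ln_le//; exact: leq_ltn_trans nk.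
have ll : ln 2 <= ln l%:R :> R by rewrite ln_le//; exact: leq_ltn_trans nl.
have : 2^-1 * 2^-1 <= ln k%:R * ln l%:R :> R.
  apply: ler_pM; rewrite ?invr_ge0//.
    exact: le_trans lk.
  exact: le_trans ll.
have : n%:R <= 2 :> R by rewrite ler_nat.
lra.
Qed.

(** * Maxima of continuous functions *)

Lemma continuous_bigsum (R : realType) (T : topologicalType) (I : finType)
    (f : I -> T -> R) :
  (forall i, continuous (f i)) -> continuous (fun x => \sum_i f i x).
Proof.
move=> cf; elim: (index_enum I) => [|i r IH] x.
  under [fun _ => _]funext do rewrite big_nil; exact: cst_continuous.
under [fun _ => _]funext do rewrite big_cons.
apply: (@continuousD _ _ _ (f i) (fun x => \sum_(j <- r) f j x)).
  exact: cf.
exact: IH.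
Qed.

Lemma continuous_bigprod (R : realType) (T : topologicalType) (I : finType)
    (f : I -> T -> R) :
  (forall i, continuous (f i)) -> continuous (fun x => \prod_i f i x).
Proof.
move=> cf; elim: (index_enum I) => [|i r IH] x.
  under [fun _ => _]funext do rewrite big_nil; exact: cst_continuous.
under [fun _ => _]funext do rewrite big_cons.
apply: (@continuousM _ _ (f i) (fun x => \prod_(j <- r) f j x)).
  exact: cf.
exact: IH.
Qed.

Lemma continuous_dotp (R : realType) (n : nat) (T : topologicalType)
    (f g : T -> 'rV[R]_n) :
  (forall i, continuous (fun x => f x 0 i)) ->
  (forall i, continuous (fun x => g x 0 i)) ->
  continuous (fun x => dotp (f x) (g x)).
Proof.
move=> cf cg; apply: continuous_bigsum => i x.
apply: (@continuousM _ _ (fun x => f x 0 i) (fun x => g x 0 i)).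
  exact: cf.
exact: cg.
Qed.

Lemma continuous_dotpr (R : realType) (n : nat) (u : 'rV[R]_n) :
  continuous (dotp u).
Proof.
apply: continuous_dotp => i; first exact: cst_continuous.
exact: coord_continuous.
Qed.

Lemma continuous_det (R : realType) (n : nat) :
  continuous (fun x : 'rV[R]_(n * n) => \det (vec_mx x)).
Proof.
apply: continuous_bigsum => s x.
apply: (@continuousM _ _ (fun=> _)); first exact: cst_continuous.
move: x; apply: continuous_bigprod => i.
under [fun _ => _]funext do rewrite mxE; exact: coord_continuous.
Qed.

Lemma closed_le_fun (R : realType) (T : topologicalType) (f : T -> R) (c : R) :
  continuous f -> closed [set x | f x <= c].
Proof.
by move=> cf; apply: (closed_comp (fun x _ => cf x) (@closed_le R c)).
Qed.

Lemma exists_max_closed_bounded (R : realType) (n : nat) (K : set 'rV[R]_n)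
    (f : 'rV[R]_n -> R) (M : R) :
  K !=set0 -> closed K -> (forall x, K x -> dotp x x <= M) -> continuous f ->
  exists2 c, K c & forall x, K x -> f x <= f c.
Proof.
move=> K0 Kcl KM cf.
have [|c] := EVT_max_rV K0 (@bounded_closed_compact R n K _ Kcl)
  (continuous_subspaceT cf).
  exists (M + 1); split=> [|r Mr x /KM xM]; first by rewrite num_real.
  rewrite /Num.Def.normr/= mx_normrE; apply: bigmax_le => [|[i j] _ /=].
    by rewrite (le_trans _ (ltW Mr))// addr_ge0// (le_trans (dotp_ge0 x)).
  rewrite ord1; have := le_trans (sqr_coord_le_dotp x j) xM.
  rewrite -real_normK ?num_real// => sqrM.
  have [x1|x1] := leP `|x 0 j| 1.
    apply: (le_trans x1); rewrite (le_trans _ (ltW Mr))// lerDr.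
    exact: le_trans sqrM.
  apply: le_trans (ltW Mr); apply: le_trans (ler_wpDr ler01 sqrM).
  by rewrite ler_eXnr// ltW.
rewrite inE => Kc cmax; exists c => // x Kx; apply: cmax; exact/mem_set.
Qed.

(** * The minimal ellipsoid of a symmetric set *)

(** Sylvester's identity: conjugating by the unipotent block matrix L moves the
    product of the two vectors from the lower right block to the upper left
    one. *)
Lemma det_1D_rank1 (R : comUnitRingType) (n : nat) (u v : 'rV[R]_n) :
  \det (1%:M + u^T *m v) = 1 + (v *m u^T) 0 0.
Proof.
pose L := block_mx (1%:M : 'M[R]_1) 0 (u^T) (1%:M : 'M[R]_n).
pose B := block_mx (1%:M : 'M[R]_1) (- v) 0 (1%:M + u^T *m v).
pose B' := block_mx (1 + v *m u^T : 'M[R]_1) (- v) 0 (1%:M : 'M[R]_n).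
have : L *m B = B' *m L.
  rewrite !mulmx_block !(mul1mx, mulmx1, mul0mx, mulmx0, addr0, add0r).
  congr block_mx.
  - by rewrite mulNmx addrK.
  - by rewrite mulmxN addrC addrK.
move/(congr1 determinant); rewrite !det_mulmx !det_ublock !det_lblock !det1.
by rewrite !(mul1r, mulr1) => ->; rewrite det_mx11 mxE mxE eqxx.
Qed.

Lemma expr1D_mul_le1 (R : realType) (n : nat) (t : R) : 0 <= t ->
  (1 + t) ^+ n * (1 - n%:R * t) <= 1.
Proof.
move=> t0; elim: n => [|n IH]; first by rewrite expr0 mul1r mul0r subr0.
apply: le_trans IH; rewrite exprS mulrAC mulrC ler_wpM2l//.
  by rewrite exprn_ge0// addr_ge0.
have := mulr_ge0 (ler0n R n.+1) (sqr_ge0 t).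
rewrite -natr1 expr2; lra.
Qed.

(** Stretching by 1 + b r in the direction of a vector of squared norm r > n
    beats the normalisation factor: to first order in b, the two sides are
    1 + 2 n b and 1 + 2 r b. *)
Lemma exists_expansion (R : realType) (n : nat) (r : R) : n%:R < r ->
  exists b : R, 0 < b /\ (1 + (2 * b + b ^+ 2 * r)) ^+ n < (1 + b * r) ^+ 2.
Proof.
move=> nr; set N : R := n%:R in nr *.
have N0 : 0 <= N by exact: ler0n.
have r0 : 0 < r by exact: le_lt_trans nr.
have Nr0 : 0 <= N * r by rewrite mulr_ge0// ltW.
(* D makes all the terms of order b^2, together, at most b (r - N), while the
   first-order gain is 2 b (r - N). *)
pose D := 5 * N + 2 * (N * r) + 1.
have D0 : 0 < D by rewrite /D; lra.
have [b b0 bD] : exists2 b, 0 < b & b * D * r = r - N.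
  have rD0 : 0 < r * D by rewrite mulr_gt0.
  exists ((r - N) / (r * D)); first by rewrite divr_gt0// subr_gt0.
  by rewrite -mulrA (mulrC D) divfK// gt_eqF.
have bD1 : b * D <= 1 by rewrite -(ler_pM2r r0) bD mul1r; lra.
have bN : 0 <= b * N by rewrite mulr_ge0// ltW.
have bNr : 0 <= b * (N * r) by rewrite mulr_ge0// ltW.
rewrite /D !mulrDr mulr1 in bD1.
have b1 : b <= 1 by lra.
pose t := 2 * b + b ^+ 2 * r.
have t0 : 0 <= t.
  by rewrite /t addr_ge0 ?mulr_ge0 ?exprn_ge0 ?(ltW b0) ?(ltW r0).
exists b; split=> //; rewrite -/t.
have Nt : N * t <= 9 / 10.
  have : b * (b * (N * r)) <= 1 * (b * (N * r)) by rewrite ler_wpM2r.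
  by rewrite /t expr2; lra.
rewrite -(ltr_pM2r (_ : 0 < 1 - N * t)); last by lra.
apply: le_lt_trans (expr1D_mul_le1 _ t0) _; rewrite -/N.
have sq : 1 + 2 * (b * r) <= (1 + b * r) ^+ 2.
  by have := sqr_ge0 (b * r); rewrite !expr2; lra.
apply: (@lt_le_trans _ _ ((1 + 2 * (b * r)) * (1 - N * t))); last first.
  by rewrite ler_pM2r//; lra.
have h1 : b * (b * (N * r)) * r <= 1 * (b * (N * r)) * r.
  by rewrite ler_wpM2r ?(ltW r0)// ler_wpM2r.
have h2 : 0 < b * (2 * (r - N) - b * (5 * N + 2 * (N * r)) * r).
  rewrite mulr_gt0//; move: bD; rewrite /D.
  have : 0 < b * r by rewrite mulr_gt0.
  lra.
have h3 : b * (b * (b * (N * r)) * r) <= b * (1 * (b * (N * r)) * r).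
  by rewrite ler_pM2l.
rewrite /t expr2; lra.
Qed.

Lemma sqr_le1 (R : realType) (z : R) : (z ^+ 2 <= 1) = (`|z| <= 1).
Proof. by rewrite -real_normK ?num_real// expr_le1. Qed.

(** This is John's theorem for the symmetric convex hull of A and -A: the set of
    all x with |x S| <= 1 is the ellipsoid of least volume around A, and the
    last conclusion is the inclusion of its copy shrunk by sqrt n in that hull,
    expressed with support functions.  At a y that violates it, put
    w = y (S^-1)^T.  Then <a S, w> = <a, y> is at most 1 in absolute value, so
    following S by 1 + b w^T w increases the squared norms |a S|^2 to at most
    1 + 2 b + b^2 |w|^2, while the determinant is multiplied by
    1 + b |w|^2. *)
Lemma exists_minimal_ellipsoid (R : realType) (n : nat)
    (A : seq 'rV[R]_n) (M : R) :
  (forall y, (forall a, a \in A -> dotp a y <= 1) -> dotp y y <= M) ->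
  exists S : 'M[R]_n, [/\ S \in unitmx,
    forall a, a \in A -> dotp (a *m S) (a *m S) <= 1 &
    forall y, (forall a, a \in A -> `|dotp a y| <= 1) ->
      dotp (y *m (invmx S)^T) (y *m (invmx S)^T) <= n%:R].
Proof.
move=> polarM.
pose feasible (S : 'M[R]_n) := forall a, a \in A -> dotp (a *m S) (a *m S) <= 1.
pose K : set 'rV[R]_(n * n) := [set x | feasible (vec_mx x)].
(* A small multiple of the identity is feasible, so the maximum is positive. *)
have [e e0 Ke] : exists2 e : R, 0 < e & feasible e%:M.
  pose d : R := 1 + \sum_(a <- A) dotp a a.
  have d1 : 1 <= d by rewrite lerDl sumr_ge0// => a _; exact: dotp_ge0.
  have d0 : 0 < d by exact: lt_le_trans d1.
  exists d^-1 => [|a aA]; first by rewrite invr_gt0.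
  rewrite mul_mx_scalar dotpZl dotpZr ler_pdivrMl// mulr1 ler_pdivrMl//.
  have ad : dotp a a <= d.
    rewrite /d (big_rem a)//= addrCA lerDl addr_ge0// sumr_ge0// => b _.
    exact: dotp_ge0.
  by apply: le_trans ad _; rewrite ler_peMr// ltW.
have closedK : closed K.
  have -> : K = \bigcap_(a in [set` A])
      [set x | dotp (a *m vec_mx x) (a *m vec_mx x) <= 1].
    by apply/seteqP; split=> x.
  apply: closed_bigI => a _; apply: closed_le_fun.
  suff cvec i : continuous (fun x : 'rV[R]_(n * n) => (a *m vec_mx x) 0 i).
    by apply: continuous_dotp.
  under [fun _ => _]funext => x.
    rewrite mxE (eq_bigr (fun j => a 0 j * x 0 (mxvec_index j i))).
      over.
    by move=> j _; rewrite mxE.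
  apply: continuous_bigsum => j x.
  apply: (@continuousM _ _ (fun=> _)); first exact: cst_continuous.
  exact: coord_continuous.
(* The columns of a feasible matrix belong to the polar body of A. *)
have boundedK x : K x -> dotp x x <= (n * n)%:R * M.
  move=> Kx; rewrite mulr_natl -[X in M *+ X]card_ord -sumr_const.
  apply: ler_sum => k _; case/mxvec_indexP: k => i j.
  pose y : 'rV[R]_n := \row_k vec_mx x k j.
  apply: (@le_trans _ _ (dotp y y)).
    by have := sqr_coord_le_dotp y i; rewrite !mxE.
  apply: polarM => a aA; have -> : dotp a y = (a *m vec_mx x) 0 j.
    by rewrite mxE; apply: eq_bigr => k _; rewrite mxE.
  have := le_trans (sqr_coord_le_dotp _ j) (Kx a aA).
  by rewrite sqr_le1; apply: le_trans; exact: ler_norm.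
have [|x0 Kx0 x0max] :=
    @exists_max_closed_bounded R (n * n) K _ _ _ closedK boundedK
      (@continuous_det R n).
  by exists (mxvec e%:M); rewrite /K/= mxvecK.
pose S := vec_mx x0; have feasS : feasible S by exact: Kx0.
have {x0max} Smax S' : feasible S' -> \det S' <= \det S.
  by have := x0max (mxvec S'); rewrite /K/= mxvecK.
move: {x0 Kx0} S feasS Smax => S feasS Smax.

have detS0 : 0 < \det S.
  apply: lt_le_trans (Smax _ Ke).
  by rewrite det_scalar exprn_gt0.
have unitS : S \in unitmx by rewrite unitmxE unitfE gt_eqF.
exists S; split=> // y yA; set w := y *m _.
rewrite leNgt; apply/negP => /exists_expansion[b [b0]]; apply/negP.
rewrite -leNgt; set t := 2 * b + _.
have t0 : 0 <= t.
  by rewrite /t addr_ge0 ?mulr_ge0 ?exprn_ge0 ?dotp_ge0 ?(ltW b0).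
have t1 : 0 < 1 + t by lra.
pose E : 'M[R]_n := 1%:M + (b *: w)^T *m w.
have feasE : feasible ((Num.sqrt (1 + t))^-1 *: (S *m E)).
  move=> a aA; rewrite -scalemxAr dotpZl dotpZr mulrA -invfM -expr2.
  rewrite sqr_sqrtr ?(ltW t1)// ler_pdivrMl// mulr1 mulmxA.
  have dw : dotp (a *m S) w = dotp a y.
    by rewrite dotp_mulmx -mulmxA -trmx_mul mulmxV// trmx1 mulmx1.
  have -> : a *m S *m E = a *m S + (b * dotp a y) *: w.
    rewrite mulmxDr mulmx1 mulmxA [_ *m (b *: w)^T]mx11_scalar -dotpE.
    by rewrite dotpZr dw mul_scalar_mx.
  rewrite !(dotpDl, dotpDr, dotpZl, dotpZr) (dotpC w) dw.
  have s1 : dotp a y ^+ 2 <= 1.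
    by rewrite sqr_le1 yA.
  have h1 := feasS a aA.
  have h2 : b * dotp a y ^+ 2 <= b * 1 by rewrite ler_pM2l.
  have h3 : b ^+ 2 * dotp w w * dotp a y ^+ 2 <= b ^+ 2 * dotp w w * 1.
    by rewrite ler_wpM2l// mulr_ge0 ?dotp_ge0// sqr_ge0.
  rewrite /t; move: h2 h3; rewrite !expr2; lra.
have := Smax _ feasE.
rewrite detZ det_mulmx det_1D_rank1 -dotpE dotpZr mulrCA ger_pMr// exprVn.
rewrite ler_pdivrMl ?exprn_gt0 ?sqrtr_gt0// mulr1 => le_sqrt.
have bw0 : 0 <= 1 + b * dotp w w.
  by rewrite addr_ge0 ?mulr_ge0 ?dotp_ge0 ?(ltW b0).
have : (1 + b * dotp w w) ^+ 2 <= (Num.sqrt (1 + t) ^+ n) ^+ 2.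
  by rewrite ler_sqr ?nnegrE// exprn_ge0// sqrtr_ge0.
by rewrite exprAC sqr_sqrtr// ltW.
Qed.

(** * Finite families of vectors *)

Section FiniteSequences.
Context {R : realType} {T : eqType}.

Lemma exists_argmax (s : seq T) (f : T -> R) : s != [::] ->
  exists2 a, a \in s & forall b, b \in s -> f b <= f a.
Proof.
elim: s => // a s IH _; have [->|/IH[c cs cmax]] := eqVneq s [::].
  by exists a => [|b]; rewrite ?mem_head// inE => /eqP ->.
have [ca|/ltW ac] := leP (f c) (f a).
  exists a => [|b]; first exact: mem_head.
  by rewrite inE => /predU1P[->//|/cmax bc]; exact: le_trans ca.
exists c => [|b]; first by rewrite inE cs orbT.
by rewrite inE => /predU1P[->//|/cmax].
Qed.

Lemma exists_small (s : seq T) (g h : T -> R) :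
  (forall a, a \in s -> 0 < g a) ->
  exists2 t, 0 < t & forall a, a \in s -> t * `|h a| < g a.
Proof.
elim: s => [_|a s IH g0]; first by exists 1.
have [b bs|t t0 Ht] := IH; first by apply: g0; rewrite inE bs orbT.
have ga0 : 0 < g a by apply: g0; exact: mem_head.
have ha0 : 0 < `|h a| + 1 by rewrite ltr_wpDl.
exists (Num.min t (g a / (`|h a| + 1))) => [|b].
  by rewrite lt_min t0 divr_gt0.
rewrite inE => /predU1P[->|bs].
  apply: (@le_lt_trans _ _ (g a / (`|h a| + 1) * `|h a|)).
    by rewrite ler_wpM2r// ge_min lexx orbT.
  by rewrite mulrAC ltr_pdivrMr// ltr_pM2l// ltrDl.
by apply: le_lt_trans (Ht b bs); rewrite ler_wpM2r// ge_min lexx.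
Qed.

End FiniteSequences.

Section LinearAlgebra.
Context {R : realType} {n : nat}.

Lemma exists_orthogonal (k : nat) (M : 'M[R]_(k, n)) : ~~ row_full M ->
  exists2 z : 'rV[R]_n, z != 0 & forall i, dotp (row i M) z = 0.
Proof.
rewrite /row_full -mxrank_tr -[_ == _]/(row_free M^T) -kermx_eq0 => kerN0.
exists (nz_row (kermx M^T)); first by rewrite nz_row_eq0.
move=> i; have /sub_kermxP/rowP/(_ i) := nz_row_sub (kermx M^T).
rewrite [RHS]mxE => <-; rewrite dotpC dotpE !mxE.
by apply: eq_bigr => j _; rewrite !mxE.
Qed.

Lemma separating_spans (s : seq 'rV[R]_n) :
  (forall z, (forall a, a \in s -> dotp a z = 0) -> z = 0) ->
  forall x, exists c : 'I_(size s) -> R, x = \sum_i c i *: s`_i.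
Proof.
move=> sep x; pose M : 'M[R]_(size s, n) := \matrix_i s`_i.
have : row_full M.
  apply/negPn/negP => /exists_orthogonal[z z0 zM].
  case/eqP: z0; apply: sep => a.
  by move=> /(nthP 0)[i si <-]; rewrite -(zM (Ordinal si)) rowK.
move=> /(submx_full x)/submxP[D ->]; exists (D 0).
by rewrite mulmx_sum_row; apply: eq_bigr => i _; rewrite rowK.
Qed.

(** If the w i are n independent vectors, all the inner products can be
    prescribed to be -1; otherwise some direction is orthogonal to all of them.
    Applied to the vertices, and to the facet normals, of a polytope around the
    origin, this bounds their numbers below by n + 1. *)
Lemma exists_nonpos (I : finType) (w : I -> 'rV[R]_n) :
  (0 < n)%N -> (#|I| <= n)%N ->
  exists2 x, x != 0 & forall i, dotp (w i) x <= 0.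
Proof.
move=> n0 In; pose M : 'M[R]_(#|I|, n) := \matrix_k w (enum_val k).
have rowM i : row (enum_rank i) M = w i by rewrite rowK enum_rankK.
have [Mfull|/exists_orthogonal[x x0 xM]] := boolP (row_full M); last first.
  by exists x => // i; rewrite -rowM xM.
have MT : row_free M^T by rewrite /row_free mxrank_tr.
have I0 : #|I| = n.
  by apply/eqP; rewrite eqn_leq In -{1}(eqP Mfull) rank_leq_row.
have MTfull : row_full M^T by rewrite /row_full (eqP MT) I0.
pose x : 'rV[R]_n := const_mx (-1) *m pinvmx M^T.
have xM : x *m M^T = const_mx (-1) by rewrite mulmxKpV// submx_full.
exists x => [|i].
  have I_gt0 : (0 < #|I|)%N by rewrite I0.
  apply/eqP => x0; move: xM; rewrite x0 mul0mx => /rowP/(_ (Ordinal I_gt0)).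
  by rewrite !mxE => /eqP; rewrite eq_sym oppr_eq0 oner_eq0.
have -> : dotp (w i) x = (x *m M^T) 0 (enum_rank i).
  rewrite dotpC dotpE !mxE; apply: eq_bigr => j _.
  by rewrite !mxE enum_rankK.
by rewrite xM mxE lerN10.
Qed.

(** Closure under combinations of two points makes the directions at p a linear
    subspace: scaling is the combination of p + w with p, and a sum is the
    midpoint of p + 2 w and p + 2 w'. *)
Lemma affine_combination (k : nat) (E : set 'rV[R]_n) (p : 'rV[R]_n)
    (a : 'I_k -> 'rV[R]_n) (c : 'I_k -> R) :
  affine_set E -> E p -> (forall i, E (a i)) ->
  E (p + \sum_i c i *: (a i - p)).
Proof.
move=> affE Ep Ea.
have dirZ t w : E (p + w) -> E (p + t *: w).
  move=> Ew; have := affE _ _ t Ew Ep; rewrite scalerDr addrAC -scalerDl.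
  by rewrite [t + _]addrC subrK scale1r.
have dirD w w' : E (p + w) -> E (p + w') -> E (p + (w + w')).
  move=> Ew Ew'; have := affE _ _ 2^-1 (dirZ 2 _ Ew) (dirZ 2 _ Ew').
  have -> : 1 - 2^-1 = 2^-1 :> R by field.
  rewrite -scalerDr addrACA -scalerDr -mulr2n -[p *+ 2]scaler_nat -scalerDr.
  by rewrite scalerA mulVf// scale1r.
apply: (big_ind (fun w => E (p + w))) => [|//|i _]; first by rewrite addr0.
by apply: dirZ; rewrite addrC subrK.
Qed.

Lemma dim_orthogonal (u : 'rV[R]_n) : u != 0 ->
  exists W : {vspace 'rV[R]_n},
    (forall w, (w \in W) = (dotp u w == 0)) /\ \dim W = n.-1.
Proof.
move=> u0; pose f : 'rV[R]_n -> R^o := dotp u.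
have lin_f : linear f by move=> t x y; rewrite /f dotpDr dotpZr.
pose fL := GRing.isLinear.Build _ _ _ _ f lin_f.
pose g : {linear 'rV[R]_n -> R^o} := HB.pack f fL.
exists (lker (linfun g)); split=> [w|]; first by rewrite memv_ker lfunE.
have := limg_ker_dim (linfun g) fullv; rewrite capfv dimvf /dim/= mul1n.
suff -> : (\dim (limg (linfun g)) = 1)%N.
  by move=> /(congr1 predn); rewrite addn1.
apply/eqP; rewrite eqn_leq; apply/andP; split.
  by rewrite (leq_trans (dimvS (subvf _)))// dimvf.
rewrite lt0n dimv_eq0; apply/eqP => im0.
have : linfun g u \in limg (linfun g) by rewrite memv_img// memvf.
by rewrite im0 memv0 lfunE/= /f dotp_eq0 (negbTE u0).
Qed.

End LinearAlgebra.

(** * Convex hulls and their faces *)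

Section ConvexHull.
Context {R : realType} {n : nat}.
Implicit Types (C S : set 'rV[R]_n) (u x : 'rV[R]_n) (b : R).

Lemma convex_setP C : @convex_set R 'rV[R]_n C <->
  forall x y t, 0 <= t -> t <= 1 -> C x -> C y -> C (t *: x + (1 - t) *: y).
Proof.
split=> [Cconv x y t t0 t1 Cx Cy|Cconv x y t].
  by have := Cconv x y (Itv01 t0 t1); rewrite !inE; apply.
by rewrite !inE => Cx Cy; exact: Cconv.
Qed.

Lemma convex_hull_convex S x y t : 0 <= t -> t <= 1 ->
  convex_hull S x -> convex_hull S y -> convex_hull S (t *: x + (1 - t) *: y).
Proof.
move=> t0 t1 Sx Sy C [Cconv SC]; apply: (convex_setP C).1 => //.
  exact: Sx. exact: Sy.
Qed.

Lemma sub_convex_hull S x : S x -> convex_hull S x.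
Proof. exact: sub_gen_smallest. Qed.

Lemma dotp_convex u x y t :
  dotp u (t *: x + (1 - t) *: y) = t * dotp u x + (1 - t) * dotp u y.
Proof. by rewrite dotpDr !dotpZr. Qed.

Lemma convex_hull_min S C :
  @convex_set R 'rV[R]_n C -> S `<=` C -> convex_hull S `<=` C.
Proof. exact: smallest_sub. Qed.

Lemma dotp_le_convex_hull S u b : (forall a, S a -> dotp u a <= b) ->
  forall x, convex_hull S x -> dotp u x <= b.
Proof.
move=> Sb; apply: (@convex_hull_min S [set x | dotp u x <= b]) => //.
apply/convex_setP => x y t t0 t1 /= xb yb; rewrite dotp_convex.
have -> : b = t * b + (1 - t) * b by ring.
by apply: lerD; rewrite ler_wpM2l// subr_ge0.
Qed.

Lemma convex_hull_set1 x : convex_hull [set x] = [set x].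
Proof.
apply/seteqP; split=> [|_ ->]; last exact: sub_convex_hull.
apply: convex_hull_min => //; apply/convex_setP => _ _ t _ _ /= -> ->.
by rewrite -scalerDl addrC subrK scale1r.
Qed.

(** The points of the half-space that are strictly inside it or in the hull of
    the generators on its boundary form a convex set; as it contains S, it
    contains the hull of S.  No convex combinations have to be written out. *)
Lemma face_convex_hull S F :
  face (convex_hull S) F -> F = convex_hull (F `&` S).
Proof.
move=> [u [b [Sb ->]]]; apply/seteqP; split=> [x [Sx xb]|x].
  suff /(_ xb) : dotp u x = b ->
    convex_hull (convex_hull S `&` [set x | dotp u x = b] `&` S) x by [].
  suff : dotp u x <= b /\ (dotp u x = b ->
    convex_hull (convex_hull S `&` [set x | dotp u x = b] `&` S) x) by case.
  move: x Sx {xb}; set E := convex_hull (_ `&` _).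
  apply: (@convex_hull_min S
    [set x | dotp u x <= b /\ (dotp u x = b -> E x)]); last first.
    move=> a Sa /=; have Ha := sub_convex_hull Sa.
    by split=> [|ab]; [exact: Sb|exact: sub_convex_hull].
  apply/convex_setP => x y t t0 t1 /= [xb Ex] [yb Ey].
  have bE : b = t * b + (1 - t) * b by ring.
  have xtb : t * dotp u x <= t * b by rewrite ler_wpM2l.
  have ytb : (1 - t) * dotp u y <= (1 - t) * b by rewrite ler_wpM2l// subr_ge0.
  rewrite dotp_convex; split; first by rewrite [leRHS]bE lerD.
  move=> eqb.
  have [t_eq0|tN0] := eqVneq t 0.
    rewrite t_eq0 in eqb *; rewrite scale0r add0r subr0 scale1r; apply: Ey; lra.
  have [t_eq1|tN1] := eqVneq t 1.
    rewrite t_eq1 in eqb *; rewrite subrr scale0r addr0 scale1r; apply: Ex; lra.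
  apply: convex_hull_convex => //.
    by apply: Ex; apply: (mulfI tN0); lra.
  have tN1' : 1 - t != 0 by rewrite subr_eq0 eq_sym.
  by apply: Ey; apply: (mulfI tN1'); lra.
apply: convex_hull_min => [|a [] //].
apply/convex_setP => y z t t0 t1 /= [Sy yb] [Sz zb].
split; first exact: convex_hull_convex.
by rewrite /= dotp_convex yb zb; ring.
Qed.

Lemma finite_faces (s : seq 'rV[R]_n) :
  finite_set (face (convex_hull [set` s])).
Proof.
pose f (m : (size s).-tuple bool) := convex_hull [set` mask m s].
apply: (@sub_finite_set _ _ (f @` setT)); last exact: finite_image.
move=> F /face_convex_hull ->.
pose p x := `[< F x >].
exists [tuple of map p (in_tuple s)] => //.
rewrite /f /=; congr convex_hull; rewrite -filter_mask.
apply/seteqP; split=> [x|x [/asboolP Fx xs]] /=; rewrite mem_filter.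
  by case/andP => /asboolP.
exact/andP.
Qed.

End ConvexHull.

Section Vertices.
Context {R : realType} {n : nat} (A : seq 'rV[R]_n).
Let P := convex_hull [set` A].

Lemma has_dim_set1 (v : 'rV[R]_n) : has_dim [set v] 0.
Proof.
exists v, 0%VS; split; last exact: dimv0.
transitivity [set v].
  apply/seteqP; split=> [|_ ->]; last exact: sub_gen_smallest.
  apply: smallest_sub => // _ _ t -> ->.
  by rewrite /= -scalerDl addrC subrK scale1r.
apply/seteqP; split=> [_ ->|_ [w /= w0 <-]].
  by exists 0; rewrite /= ?mem0v// addr0.
by move: w0; rewrite memv0 => /eqP ->; rewrite addr0.
Qed.

(** Among the points of A where y is maximal, let v have the largest norm.  By
    strict convexity of the norm, v is the only point of A at which the
    perturbed functional y + t v is maximal, for t > 0 small. *)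
Lemma exists_vertex (y : 'rV[R]_n) : A != [::] ->
  exists2 v, v \in A /\ vertices P [set v] &
    forall a, a \in A -> dotp a y <= dotp v y.
Proof.
move=> A0.
have [a1 a1A a1max] := exists_argmax (fun a => dotp a y) A0.
pose m := dotp a1 y; pose B := [seq a <- A | dotp a y == m].
have a1B : a1 \in B by rewrite mem_filter eqxx.
have B0 : B != [::] by apply/eqP => B0; rewrite B0 in a1B.
have [v] := exists_argmax (fun a => dotp a a) B0.
rewrite mem_filter => /andP[/eqP vm vA] vmax.
have [|t t0 Ht] := @exists_small R _ [seq a <- A | dotp a y < m]
    (fun a => m - dotp a y) (fun a => dotp a v - dotp v v).
  by move=> a; rewrite mem_filter subr_gt0 => /andP[].
pose u := y + t *: v; pose b := dotp u v.
have le_b a : a \in A -> dotp u a <= b /\ (dotp u a = b -> a = v).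
  move=> aA; rewrite /b /u !dotpDl !dotpZl !(dotpC y) vm.
  have := a1max a aA; rewrite -/m le_eqVlt => /orP[am|am].
    have nav := dotp_ge0 (a - v).
    have aav : dotp a a <= dotp v v by apply: vmax; rewrite mem_filter am.
    move: nav; rewrite !(dotpDl, dotpDr, dotpNl, dotpNr) (dotpC v a) (eqP am).
    move=> nav.
    have av : dotp a v <= dotp v v by lra.
    split; first by rewrite lerD2l ler_pM2l.
    move=> /addrI/(mulfI (lt0r_neq0 t0)) vav; apply/eqP.
    rewrite -subr_eq0 -dotp_eq0 !(dotpDl, dotpDr, dotpNl, dotpNr).
    apply/eqP; rewrite (dotpC v a); lra.
  have /Ht lt_t : a \in [seq a <- A | dotp a y < m] by rewrite mem_filter am.
  have : t * (dotp a v - dotp v v) <= t * `|dotp a v - dotp v v|.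
    by rewrite ler_pM2l// ler_norm.
  rewrite (dotpC v a) => h; split; first lra.
  by move=> ?; exfalso; move: h lt_t => h /= lt_t; lra.
exists v; last by move=> a /a1max; rewrite -/m -vm.
split=> //; split; last exact: has_dim_set1.
have Fface : face P (P `&` [set x | dotp u x = b]).
  exists u, b; split=> // x; apply: dotp_le_convex_hull => a /le_b[].
  by [].
suff -> : [set v] = P `&` [set x | dotp u x = b] by [].
rewrite (face_convex_hull Fface) -[LHS]convex_hull_set1; congr convex_hull.
apply/seteqP; split=> [_ ->|a [[_ ab] aA]].
  by split=> //; split=> //; exact: sub_convex_hull.
by have [_ ->] := le_b a aA.
Qed.

End Vertices.

(** * Facets and the polar body *)

Section Facets.
Context {R : realType} {n : nat} (A : seq 'rV[R]_n).
Let P := convex_hull [set` A].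

Definition polar (y : 'rV[R]_n) : Prop := forall a, a \in A -> dotp a y <= 1.

(** These are the extreme points of the polar body.  The second condition says
    that the points of A on the hyperplane of u span the whole space. *)
Definition facet_normal (u : 'rV[R]_n) : Prop :=
  polar u /\
  forall z, (forall a, a \in A -> dotp a u = 1 -> dotp a z = 0) -> z = 0.

Definition facet_of (u : 'rV[R]_n) : set 'rV[R]_n :=
  P `&` [set x | dotp u x = 1].

Lemma facet_of_inj (u v : 'rV[R]_n) :
  facet_normal u -> facet_normal v -> facet_of u = facet_of v -> u = v.
Proof.
move=> [_ sep_u] _ uv; apply/eqP; rewrite -subr_eq0; apply/eqP/sep_u => a aA au.
have [_ /= av] : facet_of v a.
  by rewrite -uv; split; [exact: sub_convex_hull|rewrite /= dotpC].
by rewrite dotpDr dotpNr au dotpC av subrr.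
Qed.

(** Any x on the hyperplane of u is a linear combination of points of A on that
    hyperplane; applying u shows that the coefficients sum to 1, so the
    combination is affine. *)
Lemma facets_facet_of (u : 'rV[R]_n) : (0 < n)%N ->
  facet_normal u -> facets P (facet_of u).
Proof.
move=> n0 [pol_u sep_u].
have u0 : u != 0.
  apply/eqP => u0; have : const_mx 1 = 0 :> 'rV[R]_n.
    by apply: sep_u => a _; rewrite u0 dotp0r => /eqP; rewrite eq_sym oner_eq0.
  by move=> /rowP/(_ (Ordinal n0)); rewrite !mxE => /eqP; rewrite oner_eq0.
have [W [memW dimW]] := dim_orthogonal u0.
split.
  exists u, 1; split=> // x; apply: dotp_le_convex_hull => a aA.
  by rewrite dotpC pol_u.
pose B := [seq a <- A | dotp a u == 1].
have span_B := @separating_spans R n B.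
have {}span_B x : exists c : 'I_(size B) -> R, x = \sum_i c i *: B`_i.
  apply: span_B => z zB; apply: sep_u => a aA au.
  by apply: zB; rewrite mem_filter au eqxx.
have B1 i : (i < size B)%N -> B`_i \in A /\ dotp u B`_i = 1.
  by move=> /(mem_nth 0); rewrite mem_filter dotpC => /andP[/eqP].
have p_ex : exists p, p \in B.
  case: (B) span_B => [|p s _]; last by exists p; exact: mem_head.
  by move=> /(_ u)[c]; rewrite big_ord0 => /eqP; rewrite (negbTE u0).
case: p_ex => p; rewrite mem_filter => /andP[/eqP pu pA].
exists p, W; split=> //; apply/seteqP; split.
  apply: smallest_sub => [x y t [w /= Ww <-] [w' /= Ww' <-]|x [_ /= xu]].
    exists (t *: w + (1 - t) *: w'); first by rewrite memvD// memvZ.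
    rewrite !scalerDr addrACA -scalerDl [t + _]addrC subrK scale1r//.
  exists (x - p); last by rewrite addrC subrK.
  by rewrite /= memW dotpDr dotpNr xu (dotpC u) pu subrr.
move=> _ [w /= Ww <-] E [affE FE].
have Ea a : a \in A -> dotp u a = 1 -> E a.
  by move=> aA au; apply: FE; split=> //; exact: sub_convex_hull.
have [c wc] := span_B w.
have c0 : \sum_i c i = 0.
  move: Ww; rewrite memW wc => /eqP uw0; apply: etrans uw0.
  rewrite (big_morph (dotp u) (fun x y => dotpDr u x y) (dotp0r u)).
  by apply: eq_bigr => i _; rewrite dotpZr (B1 i _).2// mulr1.
have -> : w = \sum_i c i *: (B`_i - p).
  rewrite (eq_bigr _ (fun i _ => scalerBr _ _ _)) sumrB -wc -scaler_suml c0.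
  by rewrite scale0r subr0.
apply: affine_combination => // [|i].
  by apply: Ea => //; rewrite dotpC.
by have [] := B1 i (ltn_ord i); exact: Ea.
Qed.

(** Let u have the largest norm among the maximisers of x on the polar body.  If
    some z <> 0 were orthogonal to all the points of A that are active at u,
    both u + t z and u - t z would stay in the polar body for t > 0 small; they
    would then be maximisers as well, and one of them would be longer
    than u. *)
Lemma exists_facet_normal (M : R) (x : 'rV[R]_n) :
  (forall y, polar y -> dotp y y <= M) ->
  exists2 u, facet_normal u & forall z, polar z -> dotp x z <= dotp x u.
Proof.
move=> polarM.
have polarE : polar = \bigcap_(a in [set` A]) [set y | dotp a y <= 1].
  by apply/seteqP; split.
have closed_polar : closed polar.
  rewrite polarE; apply: closed_bigI => a _.
  exact: closed_le_fun (@continuous_dotpr R n a).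
have polar0 : polar 0 by move=> a _; rewrite dotp0r.
have [y0 y0P y0max] := @exists_max_closed_bounded R n polar _ _
  (ex_intro _ _ polar0) closed_polar polarM (@continuous_dotpr R n x).
pose K := polar `&` [set y | dotp (- x) y <= - dotp x y0].
have closedK : closed K.
  apply: closedI => //; exact: closed_le_fun (@continuous_dotpr R n (- x)).
have cnorm : continuous (fun y : 'rV[R]_n => dotp y y).
  by apply: continuous_dotp => i; exact: coord_continuous.
have [||u [uP /= uy0] umax] :=
  @exists_max_closed_bounded R n K _ M _ closedK _ cnorm.
- by exists y0; split=> //=; rewrite dotpNl.
- by move=> y [/polarM].
have u_max z : polar z -> dotp x z <= dotp x u.
  by move=> /y0max zy0; apply: le_trans zy0 _; rewrite -lerN2 -dotpNl.
exists u => //; split=> // z z_ort; apply/eqP/negPn/negP => z0.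
have [|t t0 Ht] := @exists_small R _ [seq a <- A | dotp a u < 1]
    (fun a => 1 - dotp a u) (fun a => dotp a z).
  by move=> a; rewrite mem_filter subr_gt0 => /andP[].
have polar_move s : `|s| = t -> polar (u + s *: z).
  move=> st a aA; rewrite dotpDr dotpZr.
  have := uP a aA; rewrite le_eqVlt => /orP[/eqP au|au].
    by rewrite (z_ort a aA au) mulr0 addr0 au.
  have /Ht : a \in [seq a <- A | dotp a u < 1] by rewrite mem_filter au.
  have := ler_norm (s * dotp a z); rewrite normrM st; lra.
have pt : polar (u + t *: z) by apply: polar_move; rewrite gtr0_norm.
have pNt : polar (u + (- t) *: z).
  by apply: polar_move; rewrite normrN gtr0_norm.
have xz : dotp x z = 0.
  have := u_max _ pt; have := u_max _ pNt.
  rewrite !dotpDr !dotpZr !gerDl mulNr oppr_le0 pmulr_rge0// pmulr_rle0//.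
  by move=> h1 h2; apply/eqP; rewrite eq_le h1 h2.
have K_move s : polar (u + s *: z) -> K (u + s *: z).
  split=> //=.
  by rewrite dotpDr dotpZr [dotp (- x) z]dotpNl xz oppr0 mulr0 addr0.
have := umax _ (K_move _ pt); have := umax _ (K_move _ pNt).
rewrite !(dotpDl, dotpDr, dotpZl, dotpZr) (dotpC z u).
have : 0 < t * (t * dotp z z) by rewrite !mulr_gt0// dotp_gt0.
lra.
Qed.

End Facets.

(** * The bound for a polytope in a given position *)

(** Lists representatives v of the members g v of F, indexed by F itself so that
    the index type has as many elements as F.  A member of F of another form
    gets the harmless value 0. *)
Lemma fset_set_family (R : realType) (n : nat) (F : set (set 'rV[R]_n))
    (N : set 'rV[R]_n) (g : 'rV[R]_n -> set 'rV[R]_n) :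
  finite_set F -> (forall v, N v -> F (g v)) ->
  (forall v w, N v -> N w -> g v = g w -> v = w) ->
  exists f : fset_set F -> 'rV[R]_n,
    (forall i, N (f i) \/ f i = 0) /\ (forall v, N v -> exists i, f i = v).
Proof.
move=> finF NF g_inj.
exists (fun i => xget 0 [set v | N v /\ g v = val i]); split=> [i|v Nv].
  by case: xgetP => [v _ []|_]; [left|right].
have gvF : g v \in fset_set F by rewrite in_fset_set// inE; exact: NF.
exists [` gvF]%fset; case: xgetP => [w _ [Nw /= gw]|/(_ v)[]//].
exact: g_inj.
Qed.

Section Position.
Context {R : realType} {n : nat} (A : seq 'rV[R]_n) (r : R).
Let P := convex_hull [set` A].
Hypothesis n_gt0 : (0 < n)%N.
Hypothesis r_gt0 : 0 < r.
Hypothesis ball_sub : eball r `<=` P.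

Lemma mul_enorm_le_support (y : 'rV[R]_n) (h : R) :
  (forall a, a \in A -> dotp a y <= h) -> r * enorm y <= h.
Proof.
move=> Ah.
have Ph x : P x -> dotp y x <= h.
  by apply: dotp_le_convex_hull => a aA; rewrite dotpC Ah.
have [->|y0] := eqVneq y 0.
  rewrite /enorm dotp0r sqrtr0 mulr0 -(dotp0r y); apply: Ph; apply: ball_sub.
  by rewrite /eball/= /enorm dotp0r sqrtr0 ltW.
have ny0 : 0 < enorm y by rewrite enorm_gt0.
have -> : r * enorm y = dotp y ((r / enorm y) *: y).
  by rewrite dotpZr -sqr_enorm expr2 mulrA divfK// gt_eqF.
apply: Ph; apply: ball_sub; rewrite /eball/= /enorm dotpZl dotpZr mulrA -expr2.
rewrite sqrtrM ?sqr_ge0// sqrtr_sqr -/(enorm y).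
rewrite ger0_norm ?divr_ge0 ?(ltW r_gt0) ?(ltW ny0)//.
by rewrite divfK// gt_eqF.
Qed.

Lemma polar_enorm_le (y : 'rV[R]_n) : polar A y -> enorm y <= r^-1.
Proof.
by move=> /mul_enorm_le_support; rewrite -ler_pdivlMl// mulr1.
Qed.

Lemma polar_bounded (y : 'rV[R]_n) : polar A y -> dotp y y <= r^-1 ^+ 2.
Proof.
move=> /polar_enorm_le yr; rewrite -sqr_enorm ler_sqr ?nnegrE ?enorm_ge0//.
by rewrite invr_ge0 ltW.
Qed.

Lemma generators_neq0 : A != [::].
Proof.
apply/eqP => A0; pose y : 'rV[R]_n := const_mx 1.
have [|] := leP (r * enorm y) (-1).
  apply/negP; rewrite -ltNge (lt_le_trans (ltrN10 R))//.
  by rewrite mulr_ge0 ?enorm_ge0 ?ltW.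
by rewrite ltNge mul_enorm_le_support// A0.
Qed.

(** In [dimension_le_ln_mul_ln] the vertices are tested against S and the facet
    normals against T.  The duality inequality holds because x divided by its
    maximum over the vertices lies in the polar body, where y is at most its
    maximum over the facet normals. *)
Lemma ln_vertices_facets_ge (S T : 'M[R]_n) : S^T *m T = 1%:M ->
  (forall a, a \in A -> dotp (a *m S) (a *m S) <= 1) ->
  (forall y, polar A y -> dotp (y *m T) (y *m T) <= n%:R) ->
  9^-1 * n%:R <= log_vertices_facets P.
Proof.
move=> ST1 A_le1 polar_len.
have finF k : finite_set (faces_of_dim P k).
  by apply: sub_finite_set (@finite_faces R n A) => F [].
have [|v w _ _|v [vN v_ex]] := @fset_set_family R n (vertices P)
    [set v | v \in A /\ vertices P [set v]] (fun v => [set v]) (finF _).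
- by move=> v [].
- by move=> /seteqP[/(_ v erefl)].
have [||u [uN u_ex]] := @fset_set_family R n (facets P)
    (facet_normal A) (facet_of A) (finF _).
- by move=> u; exact: facets_facet_of.
- exact: facet_of_inj.
have vA i : v i \in A \/ v i = 0 by case: (vN i) => [[]|]; [left|right].
have upol j : polar A (u j).
  by case: (uN j) => [[]//|-> a _]; rewrite dotp0r.
have v_max x : exists i, forall a, a \in A -> dotp a x <= dotp (v i) x.
  have [w wV wmax] := exists_vertex x generators_neq0.
  by have [i vi] := v_ex w wV; exists i; rewrite vi.
have u_max x : exists j, forall z, polar A z -> dotp x z <= dotp x (u j).
  have [w wN wmax] := exists_facet_normal x polar_bounded.
  by have [j uj] := u_ex w wN; exists j; rewrite uj.
have polarZ x h : 0 < h -> (forall a, a \in A -> dotp a x <= h) ->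
    polar A (h^-1 *: x).
  by move=> h0 Ah a aA; rewrite dotpZr ler_pdivrMl// mulr1 Ah.
have nv : (n < #|` fset_set (vertices P)|)%N.
  rewrite ltnNge cardfE; apply/negP => /(exists_nonpos v n_gt0)[x x0 vx].
  have [i ivx] := v_max x; have := mul_enorm_le_support ivx.
  by apply/negP; rewrite -ltNge (le_lt_trans (vx i))// mulr_gt0// enorm_gt0.
have nu : (n < #|` fset_set (facets P)|)%N.
  rewrite ltnNge cardfE; apply/negP => /(exists_nonpos u n_gt0)[x x0 ux].
  have [i ivx] := v_max x; have [j jux] := u_max x.
  have h0 : 0 < dotp (v i) x.
    apply: lt_le_trans (mul_enorm_le_support ivx).
    by rewrite mulr_gt0// enorm_gt0.
  have := jux _ (polarZ x _ h0 ivx); rewrite dotpZr.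
  apply/negP; rewrite -ltNge [ltLHS]dotpC (le_lt_trans (ux j))//.
  by rewrite mulr_gt0 ?invr_gt0// dotp_gt0.
rewrite /log_vertices_facets; apply: (@le_ln_mul_ln R n) => //.
rewrite cardfE in nv *; rewrite cardfE in nu *.
have := @dimension_le_ln_mul_ln R n _ _ v u S T; apply => //.
- exact: leq_ltn_trans nv.
- exact: leq_ltn_trans nu.
- by move=> i; case: (vA i) => [/A_le1//|->]; rewrite mul0mx dotp0r.
- by move=> j; exact: polar_len.
move=> x y; have [i ivx] := v_max x; have [j juy] := u_max y.
have hx := mul_enorm_le_support ivx.
have h0 : 0 <= dotp (v i) x.
  by apply: le_trans hx; rewrite mulr_ge0 ?enorm_ge0 ?ltW.
exists i, j; split=> //.
  by rewrite dotpC -[leLHS](dotp0r y); apply: juy => a _; rewrite dotp0r.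
have [x0|x0] := eqVneq x 0; first by rewrite x0 dotp0l dotp0r mul0r.
have hx0 : 0 < dotp (v i) x.
  by apply: lt_le_trans hx; rewrite mulr_gt0// enorm_gt0.
have := juy _ (polarZ x _ hx0 ivx); rewrite dotpZr ler_pdivrMl//.
by rewrite (dotpC x) (dotpC (u j)).
Qed.

End Position.

(** * The two classes of polytopes *)

(** Around an interior point p, both p + x and -(p - x) belong to the body for
    small x, and x is their midpoint. *)
Lemma symmetric_body_eball (R : realType) (n : nat) (S : set 'rV[R]_n) :
  symmetric_body (convex_hull S) ->
  exists2 r : R, 0 < r & eball r `<=` convex_hull S.
Proof.
move=> [[p /nbhs_ballP[e /= e0 ball_e]] symP].
have oppP x : convex_hull S x -> convex_hull S (- x).
  by move=> Sx; rewrite symP; exists x.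
exists (e / 2) => [|x]; first by rewrite divr_gt0.
rewrite /eball/= => xe.
have Px z : enorm z <= e / 2 -> convex_hull S (p + z).
  move=> ze; apply: ball_e; split=> // i j.
  rewrite /ball/= mxE opprD addNKr normrN.
  have : `|z i j| <= enorm z.
    by rewrite ord1 -sqrtr_sqr ler_sqrt ?dotp_ge0// sqr_coord_le_dotp.
  lra.
have xN : enorm (- x) <= e / 2 by rewrite /enorm dotpNl dotpNr opprK.
have := @convex_hull_convex R n S (p + x) (- (p - x)) 2^-1.
have -> : 1 - 2^-1 = 2^-1 :> R by field.
rewrite -scalerDr opprB [x - p]addrC addrACA subrr add0r scalerDr -scalerDl.
have -> : 2^-1 + 2^-1 = 1 :> R by field.
rewrite scale1r.
apply; rewrite ?invr_ge0 ?invf_le1 ?ler1n//; first exact: Px.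
by have := oppP _ (Px _ xN); rewrite opprD opprK.
Qed.

Lemma polytope_generators (R : realType) (n : nat) (P : set 'rV[R]_n) :
  polytope P -> exists A : seq 'rV[R]_n, P = convex_hull [set` A].
Proof. by move=> [_ [/finite_seqP[A ->] _ ->]]; exists A. Qed.

Lemma symmetric_ln_vertices_facets_ge (R : realType) (n : nat)
    (P : set 'rV[R]_n) :
  (0 < n)%N -> polytope P -> symmetric_body P ->
  9^-1 * n%:R <= log_vertices_facets P.
Proof.
move=> n0 /polytope_generators[A ->] symP.
have [r r0 ball_sub] := symmetric_body_eball symP.
have [S [unitS S_le1 S_polar]] :=
  exists_minimal_ellipsoid (polar_bounded r0 ball_sub).
apply: (ln_vertices_facets_ge n0 r0 ball_sub (S := S) (T := (invmx S)^T)) => //.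
  by rewrite -trmx_mul mulVmx// trmx1.
move=> y y_pol; apply: S_polar => a aA.
rewrite ler_norml y_pol// andbT lerNl -dotpNl dotpC.
apply: (@dotp_le_convex_hull R n [set` A]) => [b bA|].
  by rewrite dotpC y_pol.
by rewrite symP.2; exists a => //; exact: sub_convex_hull.
Qed.

Lemma between_balls_ln_vertices_facets_ge (R : realType) (n : nat)
    (P : set 'rV[R]_n) :
  (0 < n)%N -> polytope P -> between_balls P ->
  9^-1 * n%:R <= log_vertices_facets P.
Proof.
move=> n0 /polytope_generators[A ->] [ball_sub sub_ball].
have sn0 : 0 < Num.sqrt (n%:R : R) by rewrite sqrtr_gt0 ltr0n.
apply: (ln_vertices_facets_ge n0 ltr01 ball_sub
  (S := (Num.sqrt n%:R)^-1%:M) (T := (Num.sqrt n%:R)%:M)).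
- by rewrite tr_scalar_mx -scalar_mxM mulVf// gt_eqF.
- move=> a aA; rewrite mul_mx_scalar dotpZl dotpZr mulrA -invfM -expr2.
  rewrite ler_pdivrMl ?exprn_gt0// mulr1 -sqr_enorm.
  rewrite ler_sqr ?nnegrE ?enorm_ge0 ?(ltW sn0)//.
  by apply: sub_ball; exact: sub_convex_hull.
- move=> y /(polar_bounded ltr01 ball_sub); rewrite invr1 expr1n => y1.
  rewrite mul_mx_scalar dotpZl dotpZr mulrA -expr2 sqr_sqrtr//.
  by rewrite ler_piMr.
Qed.

Theorem theorem1 (R : realType) :
  (exists c : R, 0 < c /\
    (forall (n : nat) (P : set 'rV[R]_n), (0 < n)%N ->
      polytope P -> symmetric_body P ->
      c * n%:R <= log_vertices_facets P) /\
    (forall (n : nat) (P : set 'rV[R]_n), (0 < n)%N ->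
      polytope P -> between_balls P ->
      c * n%:R <= log_vertices_facets P)) /\
  (exists c_ : nat -> R,
    c_ n @[n --> \oo] --> (9%:R^-1 : R) /\
    (forall (n : nat) (P : set 'rV[R]_n), (0 < n)%N ->
      polytope P -> (symmetric_body P \/ between_balls P) ->
      c_ n * n%:R <= log_vertices_facets P)).
Proof.
split.
  exists 9^-1; split; first by rewrite invr_gt0.
  split=> n P; first exact: symmetric_ln_vertices_facets_ge.
  exact: between_balls_ln_vertices_facets_ge.
exists (fun=> 9^-1); split; first exact: cvg_cst.
move=> n P n0 polyP [symP|btwP]; first exact: symmetric_ln_vertices_facets_ge.
exact: between_balls_ln_vertices_facets_ge.
Qed.
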